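(* Let $n\geq 3$ and let $Q$ be the $n$-Kronecker quiver over an algebraically closed field $k$. Then there are infinitely many GR segments for $Q$.
   Context: The $n$-Kronecker quiver $Q$ has two vertices $1,2$ and $n$ arrows from $2$ to $1$. A module is a finite-dimensional representation of $Q$ over $k$; $|M|$ is the length of $M$ (its total dimension). Gabriel-Roiter (GR) measure: subsets of $\mathbb{N}=\{1,2,\ldots\}$ are totally ordered by: for $I\neq J$, $I<J$ iff the smallest element of $(I\setminus J)\cup(J\setminus I)$ belongs to $J$. $\mu(M)$ is the maximum of the sets $\{|M_1|,\ldots,|M_t|\}$ over all chains $M_1\subset M_2\subset\cdots\subset M_t$ (proper inclusions) of indecomposable submodules of $M$. A set $I$ is a GR measure (for $Q$) if $I=\mu(M)$ for some indecomposable module $M$. A GR measure $I'$ is a direct successor of a GR measure $I$, and $I$ is a direct predecessor of $I'$, if $I<I'$ and there is no GR measure $I''$ with $I<I''<I'$. A GR segment is a nonempty sequence of GR measures, indexed by an interval of integers, in which each term is the direct successor of the preceding one, and which is closed under direct successors and direct predecessors (whenever these exist); equivalently, it is an equivalence class of GR measures under the equivalence relation generated by ''is a direct successor of''. GR segments are counted as sets of GR measures. *)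

(* Defs.v *)
From HB Require Import structures.
From mathcomp Require Import all_boot all_order all_algebra.
From mathcomp Require Import boolp classical_sets functions cardinality.

Set Implicit Arguments.
Unset Strict Implicit.
Unset Printing Implicit Defensive.

Import Order.TTheory GRing.Theory Num.Theory.
Local Open Scope classical_set_scope.
Local Open Scope ring_scope.

(* The arrows go from vertex 2 to vertex 1. *)
Record kronecker_module (k : fieldType) (n : nat) := KroneckerModule {
  space1 : vectType k;
  space2 : vectType k;
  arrow : 'I_n -> 'Hom(space2, space1)
}.

Section Submodules.
Variables (k : fieldType) (n : nat) (M : kronecker_module k n).

Definition subspaces : Type := ({vspace space1 M} * {vspace space2 M})%type.

Implicit Types U W A B : subspaces.

Definition submodule U : bool :=
  [forall a : 'I_n, (arrow M a @: U.2 <= U.1)%VS].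

Definition zero_sub : subspaces := (0%VS, 0%VS).
Definition full_sub : subspaces := (fullv, fullv).

Definition add_sub A B : subspaces := ((A.1 + B.1)%VS, (A.2 + B.2)%VS).
Definition cap_sub A B : subspaces := ((A.1 :&: B.1)%VS, (A.2 :&: B.2)%VS).

Definition proper_sub U W : bool :=
  [&& (U.1 <= W.1)%VS, (U.2 <= W.2)%VS & U != W].

Definition length_sub U : nat := (\dim U.1 + \dim U.2)%N.

(* The submodules of the module U are the submodules of M contained in U; the
   summands A and B below are contained in U because their sum is U. *)
Definition indecomposable_sub U : Prop :=
  [/\ submodule U,
      U <> zero_sub
    & forall A B, submodule A -> submodule B ->
        add_sub A B = U -> cap_sub A B = zero_sub ->
        A = zero_sub \/ B = zero_sub].

Definition indecomposable : Prop := indecomposable_sub full_sub.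

(* The empty chain contributes only the empty set, which is the least subset of
   nat for [gr_lt]; it is relevant only when M is zero. *)
Definition indecomposable_chain (s : seq subspaces) : Prop :=
  sorted proper_sub s /\ (forall U, U \in s -> indecomposable_sub U).

Definition chain_lengths : set (set nat) :=
  [set I | exists2 s, indecomposable_chain s
                    & I = [set l | l \in map length_sub s]].

End Submodules.

Definition gr_lt (I J : set nat) : Prop :=
  exists m : nat,
    [/\ ((I `\` J) `|` (J `\` I)) m,
        (forall i, ((I `\` J) `|` (J `\` I)) i -> (m <= i)%N)
      & J m].

(* [is_mu M I] means that mu(M) exists and is equal to I. *)
Definition is_mu (k : fieldType) (n : nat) (M : kronecker_module k n)
    (I : set nat) : Prop :=
  chain_lengths M I /\ (forall J, chain_lengths M J -> J = I \/ gr_lt J I).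

Definition gr_measure (k : fieldType) (n : nat) (I : set nat) : Prop :=
  exists M : kronecker_module k n, indecomposable M /\ is_mu M I.

Definition direct_successor (k : fieldType) (n : nat) (I I' : set nat) : Prop :=
  [/\ gr_measure k n I, gr_measure k n I', gr_lt I I'
    & ~ exists I'', [/\ gr_measure k n I'', gr_lt I I'' & gr_lt I'' I']].

(* A segment is the set of terms of its sequence [u], indexed by the nonempty
   interval [D] of integers; the values of [u] outside of [D] are irrelevant. *)
Definition gr_segment (k : fieldType) (n : nat) (S : set (set nat)) : Prop :=
  exists (D : interval int) (u : int -> set nat),
    [/\ exists i, i \in D,
        S = [set u i | i in [set` D]],
        forall i, i \in D -> gr_measure k n (u i),
        forall i, i \in D -> i + 1 \in D ->
          direct_successor k n (u i) (u (i + 1))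
      & forall I J, direct_successor k n I J -> (S I <-> S J)].

(* Main.v *)
(* Two measures in one segment have only finitely many measures between them, so
   it suffices to find pairwise separated infinite families of measures.  If one
   arrow of M is injective, then dim U2 <= dim U1 for every submodule U, and the
   second dimension grows strictly along chains of indecomposable nonsimple
   submodules; hence mu(M) is at most {1,2,4,6,8,...}, with agreement up to 2d
   exactly when there is a chain of indecomposable submodules of dimension vectors
   (1,0), (1,1), (2,2), ..., (d,d).  Taking V1 = V2 = k^N and the arrows id, b, c,
   ..., c with b a nilpotent Jordan block, the submodules of dimension vector (e,e)
   are given by the c-invariant ker b^e.  Choosing c so that ker b^e is c-invariant
   for e <= d but not for e = d+1 makes mu(M) start with {1,2,4,...,2d} and omit
   2d+1 and 2d+2.  Each d yields infinitely many measures as N varies. *)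

Require Import Defs.
From mathcomp Require Import all_boot all_order all_algebra.
From mathcomp Require Import boolp classical_sets functions cardinality.
From mathcomp Require Import zify.

Set Implicit Arguments.
Unset Strict Implicit.
Unset Printing Implicit Defensive.
Import Order.TTheory GRing.Theory Num.Theory.
Local Open Scope classical_set_scope.

(** * The order on sets of natural numbers *)

Lemma gr_ltP (I J : set nat) :
  gr_lt I J <-> exists m, [/\ forall i, i < m -> (I i <-> J i), ~ I m & J m].
Proof.
split=> [[m [dm mmin Jm]]|[m [eqIJ nIm Jm]]]; exists m; split=> //.
- move=> i ltim; split=> [Ii|Ji]; apply: contrapT => nXi.
  + by have: m <= i by [apply: mmin; left]; rewrite leqNgt ltim.
  + by have: m <= i by [apply: mmin; right]; rewrite leqNgt ltim.
- by case: dm => -[].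
- by right.
- move=> i di; rewrite leqNgt; apply/negP => /eqIJ.
  by case: di => -[]; tauto.
Qed.

Lemma gr_lt_irr I : ~ gr_lt I I.
Proof. by case/gr_ltP => m []. Qed.

Lemma gr_lt_trans I J K : gr_lt I J -> gr_lt J K -> gr_lt I K.
Proof.
move=> /gr_ltP[m [eIJ nIm Jm]] /gr_ltP[p [eJK nJp Kp]]; apply/gr_ltP.
have [ltmp|ltpm|eqmp] := ltngtP m p; last by rewrite eqmp in Jm.
- exists m; split=> //; last by apply/eJK.
  by move=> i ltim; rewrite eIJ // eJK // (ltn_trans ltim).
- exists p; split=> //; last by rewrite eIJ.
  by move=> i ltip; rewrite eIJ ?eJK // (ltn_trans ltip).
Qed.

Lemma gr_lt_total I J : [\/ I = J, gr_lt I J | gr_lt J I].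
Proof.
have [->|/eqP neqIJ] := eqVneq I J; first by constructor 1.
have exD : exists m, `[< (I m /\ ~ J m) \/ (J m /\ ~ I m) >].
  apply: contrapT => nD; apply: neqIJ; apply/seteqP; split=> i Xi;
    apply: contrapT => nXi; apply: nD; exists i; apply/asboolP; tauto.
have [m /asboolP dm mmin] := ex_minnP exD.
have eqb i : i < m -> (I i <-> J i).
  move=> ltim; split=> [Xi|Xi]; apply: contrapT => nXi;
    suff: m <= i by [rewrite leqNgt ltim]; apply: mmin; apply/asboolP; tauto.
case: dm => -[Xm nXm]; [constructor 3|constructor 2]; apply/gr_ltP; exists m;
  split=> // i lti; have := eqb i lti; tauto.
Qed.

(** The list may contain sets that fail [Q], so any finite list covering the candidates yields a
    maximum. *)
Lemma gr_max_seq (s : seq (set nat)) (Q : set nat -> Prop) :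
  (exists2 I, I \in s & Q I) ->
  exists2 I, Q I & forall J, J \in s -> Q J -> J = I \/ gr_lt J I.
Proof.
elim: s => [[]//|K s IHs] [I0 I0s QI0].
have [exQ|nQ] := pselect (exists2 I, I \in s & Q I); last first.
  have noQ J : J \in s -> ~ Q J by move=> Js QJ; apply: nQ; exists J.
  have eqI0 : I0 = K.
    by move: I0s; rewrite inE => /orP[/eqP//|/noQ].
  by exists I0 => // J; rewrite inE eqI0 => /orP[/eqP->|/noQ//]; left.
have [I QI Imax] := IHs exQ.
have [QK|nQK] := pselect (Q K); last first.
  by exists I => // J; rewrite inE => /orP[/eqP->//|]; apply: Imax.
have [eqKI|ltKI|ltIK] := gr_lt_total K I.
- by exists I => // J; rewrite inE => /orP[/eqP->|]; [left|apply: Imax].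
- by exists I => // J; rewrite inE => /orP[/eqP->|]; [right|apply: Imax].
- exists K => // J; rewrite inE => /orP[/eqP->|Js QJ]; first by left.
  by right; have [->|/gr_lt_trans] := Imax J Js QJ; last exact.
Qed.

(** * Maximal orbits of a functional relation *)

Section Iteration.
Variables (T : Type) (R : T -> T -> Prop).
Hypothesis Rfun : forall x y z, R x y -> R x z -> y = z.

(* [None] stands for the absence of a bound. *)
Definition within (b : option nat) (t : nat) := if b is Some m then t <= m else true.

Lemma maximal_orbit (x : T) : exists (b : option nat) (f : nat -> T),
  [/\ f 0 = x, forall t, within b t.+1 -> R (f t) (f t.+1)
    & forall t y, within b t -> R (f t) y -> within b t.+1 /\ y = f t.+1].
Proof.
(* The implication makes [next] total; its value at a point without successor is unconstrained. *)
have step y : exists z, (exists z', R y z') -> R y z.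
  by have [[z Ryz]|nR] := pselect (exists z, R y z); [exists z|exists y].
have [next nextP] := choice step.
pose f t := iter t next x.
have [exstop|nstop] := pselect (exists t, ~ exists z, R (f t) z); last first.
  have Rf t : R (f t) (f t.+1).
    by apply: nextP; apply: contrapT => nR; apply: nstop; exists t.
  by exists None, f; split=> // t y _ Ry; split=> //; exact: Rfun Ry (Rf t).
have exstop' : exists t, `[< ~ exists z, R (f t) z >].
  by have [t ?] := exstop; exists t; apply/asboolP.
have [m /asboolP mstop mmin] := ex_minnP exstop'.
have Rf t : t < m -> R (f t) (f t.+1).
  move=> lttm; apply: nextP; apply: contrapT => nR.
  by have: m <= t by [apply/mmin/asboolP]; rewrite leqNgt lttm.
exists (Some m), f; split=> // t y /= letm Ry.
have lttm : t < m.
  by rewrite ltn_neqAle letm andbT; apply: contra_notN mstop => /eqP <-; exists y.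
by split=> //; exact: Rfun Ry (Rf _ lttm).
Qed.

End Iteration.

Lemma infinite_set_injection T (A : set T) (f : nat -> T) :
  injective f -> (forall i, A (f i)) -> infinite_set A.
Proof.
move=> finj fA finA; apply: infinite_nat.
have -> : [set: nat] = f @^-1` A by apply/seteqP; split=> // i _; apply: fA.
apply: card_le_finite finA; apply: card_ge_preimage => i j _ _; exact: finj.
Qed.

(** * Existence of segments and a criterion for infinitely many of them *)

Section Segments.
Variables (k : fieldType) (n : nat).
Local Notation dsucc := (direct_successor k n).
Local Notation grm := (gr_measure k n).

Lemma direct_successor_unique I J K : dsucc I J -> dsucc I K -> J = K.
Proof.
move=> [_ mJ ltIJ nJ] [_ mK ltIK nK].
by have [//|ltJK|ltKJ] := gr_lt_total J K; [case: nK; exists J|case: nJ; exists K].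
Qed.

Lemma direct_predecessor_unique I J K : dsucc J I -> dsucc K I -> J = K.
Proof.
move=> [mJ _ ltIJ nJ] [mK _ ltIK nK].
by have [//|ltJK|ltKJ] := gr_lt_total J K; [case: nJ; exists K|case: nK; exists J].
Qed.

(** Direct successors and direct predecessors are followed from [I] as long as they exist, and the
    two orbits are glued at index 0. Their maximality gives the closure condition. *)
Lemma gr_segment_exists I : grm I -> exists2 S, gr_segment k n S & S I.
Proof.
move=> mI.
have [bf [f [f0 fS fmax]]] := maximal_orbit direct_successor_unique I.
have [bg [g [g0 gS gmax]]] :=
  maximal_orbit (fun x y z => @direct_predecessor_unique x y z) I.
(* [Negz t] is -(t+1), hence the shift in [g]; the shared start [f 0 = g 0 = I] sits at [Posz 0]. *)
pose u (i : int) := match i with Posz t => f t | Negz t => g t.+1 end.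
pose D : interval int :=
  Interval (if bg is Some m then BLeft (- Posz m)%R else -oo%O)
           (if bf is Some m then BRight (Posz m) else +oo%O).
have DP t : (Posz t \in D) = within bf t.
  by rewrite in_itv /D; case: (bf) => [m|]; case: (bg) => [p|] //=; lia.
have DN t : (Negz t \in D) = within bg t.+1.
  by rewrite in_itv /D; case: (bf) => [m|]; case: (bg) => [p|] //=; lia.
have uS i : i \in D -> (i + 1)%R \in D -> dsucc (u i) (u (i + 1)%R).
  case: i => [t|[|t]].
  - have -> : (Posz t + 1)%R = Posz t.+1 by lia.
    by move=> _; rewrite DP; apply: fS.
  - have -> : (Negz 0 + 1)%R = Posz 0 by lia.
    by rewrite DN /= f0 -g0 => /gS.
  - have -> : (Negz t.+1 + 1)%R = Negz t by lia.
    by rewrite DN /= => /gS.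
have umax i J : i \in D -> dsucc (u i) J -> (i + 1)%R \in D /\ J = u (i + 1)%R.
  case: i => [t|[|t]].
  - have -> : (Posz t + 1)%R = Posz t.+1 by lia.
    by rewrite !DP; apply: fmax.
  - have -> : (Negz 0 + 1)%R = Posz 0 by lia.
    rewrite DN DP /= => /gS; rewrite g0 f0 => s1 s2; split; first by case: (bf).
    exact: direct_successor_unique s2 s1.
  - have -> : (Negz t.+1 + 1)%R = Negz t by lia.
    rewrite !DN /= => Dt s2; split; first by case: (bg) Dt => //= m /ltnW.
    exact: direct_successor_unique s2 (gS _ Dt).
have umin i J : i \in D -> dsucc J (u i) -> (i - 1)%R \in D /\ J = u (i - 1)%R.
  case: i => [[|t]|t].
  - have -> : (Posz 0 - 1)%R = Negz 0 by lia.
    rewrite DN /= f0 -g0 => _; apply: gmax; by case: (bg).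
  - have -> : (Posz t.+1 - 1)%R = Posz t by lia.
    rewrite !DP /= => Dt s2; split; first by case: (bf) Dt => //= m /ltnW.
    exact: direct_predecessor_unique s2 (fS _ Dt).
  - have -> : (Negz t - 1)%R = Negz t.+1 by lia.
    by rewrite !DN /=; apply: gmax.
have D0 : 0%R \in D by rewrite DP; case: (bf).
exists [set u i | i in [set` D]]; last by exists 0%R.
exists D, u; split=> //; first by exists 0%R.
- move=> [[|t]|t]; first by rewrite /= f0.
  + by rewrite DP => /fS [].
  + by rewrite DN => /gS [].
- move=> J K sJK; split=> -[i Di] eqi.
  + rewrite -eqi in sJK; have [Di1 ->] := umax i K Di sJK.
    by exists (i + 1)%R.
  + rewrite -eqi in sJK; have [Di1 ->] := umin i J Di sJK.
    by exists (i - 1)%R.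
Qed.

(** Nothing lies strictly between consecutive terms, so prolonging the sequence by one step adds at
    most one measure to the interval: the former endpoint. *)
Lemma finite_between_in_segment S I J : gr_segment k n S -> S I -> S J ->
  gr_lt I J -> finite_set [set K | [/\ grm K, gr_lt I K & gr_lt K J]].
Proof.
move=> [D [u [_ -> mu uS _]]] [i Di <-] [j Dj <-] ltuij {I J}.
have steps (i0 : int) (t : nat) : i0 \in D -> (i0 + Posz t)%R \in D ->
  [/\ u i0 = u (i0 + Posz t)%R \/ gr_lt (u i0) (u (i0 + Posz t)%R) &
  finite_set [set K | [/\ grm K, gr_lt (u i0) K & gr_lt K (u (i0 + Posz t)%R)]]].
  move=> D0; elim: t => [|t IHt] Dt.
    rewrite addr0; split; first by left.
    apply: (sub_finite_set _ (finite_set0 _)) => K [_ lt1 lt2].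
    exact: gr_lt_irr (gr_lt_trans lt1 lt2).
  have Dt1 : (i0 + Posz t)%R \in D.
    by move: D0 Dt; case: (D) => [[[]?|[]] [[]?|[]]]; rewrite !in_itv /=; lia.
  have {IHt} [le0t fin] := IHt Dt1.
  have eqS : (i0 + Posz t.+1 = (i0 + Posz t) + 1)%R by lia.
  rewrite eqS in Dt *; have [_ _ ltS noS] := uS _ Dt1 Dt.
  split; first by right; case: le0t => [->//|/gr_lt_trans]; apply.
  apply: (sub_finite_set (B := _ `|` [set u (i0 + Posz t)%R]) _).
    2: by rewrite finite_setU; split; [exact: fin|exact: finite_set1].
  move=> K [mK lt1 lt2].
  have [->|ltK|gtK] := gr_lt_total K (u (i0 + Posz t)%R); [by right|by left|].
  by case: noS; exists K.
have [leij|ltji] := lerP i j.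
  have eqj : (j = i + Posz `|j - i|%N)%R by lia.
  by rewrite eqj; apply: (steps _ _ Di _).2; rewrite -eqj.
(* If j < i, monotonicity puts [u j] at or below [u i], against the assumption that [u i] is
   smaller. *)
have eqi : (i = j + Posz `|i - j|%N)%R by lia.
have Di' : (j + Posz `|i - j|%N)%R \in D by rewrite -eqi.
have [leji _] := steps _ _ Dj Di'; rewrite -eqi in leji.
case: (gr_lt_irr (I := u i)); case: leji => [eqji|]; first by rewrite -{2}eqji.
exact: gr_lt_trans ltuij.
Qed.

(** The witnesses from the even classes lie in distinct segments: between [w d.*2] and [w e.*2] with
    d < e lies the whole infinite class [C d.*2.+1]. *)
Lemma infinitely_many_segments (C : nat -> set (set nat)) :
  (forall d, infinite_set [set I | grm I /\ C d I]) ->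
  (forall d I J, C d I -> C d.+1 J -> gr_lt I J) ->
  infinite_set [set S | gr_segment k n S].
Proof.
move=> infC ltC.
have exI d : exists I, grm I /\ C d I by have [I] := infinite_setN0 (infC d); exists I.
have [w wP] := choice exI.
have exS d : exists S, gr_segment k n S /\ S (w d.*2).
  by have [S] := gr_segment_exists (wP d.*2).1; exists S.
have [S SP] := choice exS.
have wmono : {homo w : d e / d < e >-> gr_lt d e}.
  apply: homo_ltn => [J I K|d]; first exact: gr_lt_trans.
  exact: ltC (wP d).2 (wP d.+1).2.
have Sneq d e : d < e -> S d <> S e.
  move=> ltde eqS.
  have Swe : S d (w e.*2) by rewrite eqS; exact: (SP e).2.
  have ltw : gr_lt (w d.*2) (w e.*2) by apply: wmono; lia.
  apply: (infC d.*2.+1).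
  apply: (sub_finite_set _ (finite_between_in_segment (SP d).1 (SP d).2 Swe ltw)).
  move=> K [mK CK]; split=> //; first exact: ltC (wP d.*2).2 CK.
  have ltK := ltC _ _ _ CK (wP d.*2.+2).2.
  have [eqe|lte] : d.*2.+2 = e.*2 \/ d.*2.+2 < e.*2 by lia.
    by rewrite -eqe.
  exact: gr_lt_trans ltK (wmono _ _ lte).
apply: (@infinite_set_injection _ _ S) => [d e eqS|d]; last exact: (SP d).1.
by have [/Sneq|/Sneq/nesym|//] := ltngtP d e.
Qed.

End Segments.

(** * Chains of indecomposable submodules and the measure of a module *)

Section Chains.
Variables (k : fieldType) (n : nat) (M : kronecker_module k n).
Implicit Types (U W A X : subspaces M) (s : seq (subspaces M)).

Lemma sub_eqP U W : (U.1 <= W.1)%VS -> (U.2 <= W.2)%VS ->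
  length_sub W <= length_sub U -> U = W.
Proof.
rewrite /length_sub => s1 s2 le; have d1 := dimvS s1; have d2 := dimvS s2.
have /eqP e1 : U.1 == W.1 by rewrite eqEdim s1; lia.
have /eqP e2 : U.2 == W.2 by rewrite eqEdim s2; lia.
by apply: injective_projections.
Qed.

Lemma length_sub_proper U W : Defs.proper_sub U W -> length_sub U < length_sub W.
Proof.
case/and3P => s1 s2 neq; rewrite ltnNge; apply: contraNN neq => le.
by rewrite (sub_eqP s1 s2 le).
Qed.

Lemma proper_sub_trans : transitive (@Defs.proper_sub k n M).
Proof.
move=> W U X lUW lWX; have ltUW := length_sub_proper lUW.
have ltWX := length_sub_proper lWX.
case/and3P: lUW => s1 s2 _; case/and3P: lWX => t1 t2 _; apply/and3P; split.
- exact: subv_trans s1 t1.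
- exact: subv_trans s2 t2.
- by apply: contraTneq (ltn_trans ltUW ltWX) => ->; rewrite ltnn.
Qed.

Lemma chain_proper s U W : indecomposable_chain s -> U \in s -> W \in s ->
  length_sub U < length_sub W -> Defs.proper_sub U W.
Proof.
move=> [+ _] Us Ws ltUW; rewrite (sorted_pairwise proper_sub_trans).
move=> /(pairwiseP U) pw.
have ltU : index U s < size s by rewrite index_mem.
have ltW : index W s < size s by rewrite index_mem.
have [lt|lt|eq] := ltngtP (index U s) (index W s).
- by have := pw _ _ ltU ltW lt; rewrite !nth_index.
- have := length_sub_proper (pw _ _ ltW ltU lt).
  by rewrite !nth_index // ltnNge (ltnW ltUW).
- have eqUW : U = W by rewrite -(nth_index U Us) -(nth_index U Ws) eq.
  by rewrite eqUW ltnn in ltUW.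
Qed.

Lemma length_sub_max U : length_sub U <= length_sub (full_sub M).
Proof. by rewrite leq_add // dimvS // subvf. Qed.

Lemma length_sub_eq0 U : length_sub U = 0 -> U = zero_sub M.
Proof. by move=> U0; apply/esym/sub_eqP; rewrite ?sub0v ?U0. Qed.

Lemma chain_lengths_bound I l : chain_lengths M I -> I l ->
  0 < l <= length_sub (full_sub M).
Proof.
move=> [s [_ ind] ->] /= /mapP[U Us ->]; rewrite length_sub_max andbT lt0n.
by apply/eqP => /length_sub_eq0; case: (ind U Us).
Qed.

(** All lengths are at most |M|, so only finitely many sets compete, and the empty chain provides
    one. *)
Lemma mu_exists : exists I, is_mu M I.
Proof.
pose L := (length_sub (full_sub M)).+1.
pose s := [seq [set l | exists2 i, i \in A & l = nat_of_ord i]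
            | A : {set 'I_L}] : seq (set nat).
have inS I : chain_lengths M I -> I \in s.
  move=> cI; apply/mapP; exists [set i : 'I_L | `[< I i >]]%SET.
    by rewrite mem_enum.
  apply/seteqP; split=> l /=.
    move=> Il; have /andP[_ ltl] := chain_lengths_bound cI Il.
    by exists (Ordinal (ltl : l < L)) => //; rewrite inE; apply/asboolP.
  by move=> [i iI ->]; move: iI; rewrite inE => /asboolP.
have c0 : chain_lengths M set0.
  by exists [::] => //; apply/seteqP; split.
have [I cI Imax] : exists2 I, chain_lengths M I &
    forall J, J \in s -> chain_lengths M J -> J = I \/ gr_lt J I.
  by apply: gr_max_seq; exists set0; [exact: inS|].
by exists I; split=> // J cJ; apply: Imax => //; apply: inS.
Qed.

(** Appending M to a chain that attains the maximum but misses M enlarges its set of lengths, and a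
    superset is never smaller; by maximality |M| is already in [I]. *)
Lemma mu_length I : indecomposable M -> is_mu M I ->
  I (length_sub (full_sub M)).
Proof.
move=> indM [[s [srt ind] eqI] Imax]; rewrite eqI /=.
have [fs|nfs] := boolP (full_sub M \in s); first exact: map_f.
pose J : set nat := [set l | l \in map (@length_sub k n M) (rcons s (full_sub M))].
have cJ : chain_lengths M J.
  exists (rcons s (full_sub M)) => //; split.
    move: srt; rewrite !(sorted_pairwise proper_sub_trans) pairwise_rcons => ->.
    rewrite andbT; apply/allP => U Us; rewrite /Defs.proper_sub !subvf /=.
    by apply: contraNneq nfs => <-.
  by move=> U; rewrite mem_rcons inE => /orP[/eqP->//|/ind].
have subIJ l : I l -> J l by rewrite eqI /J /= map_rcons mem_rcons inE => ->; rewrite orbT.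
have Jf : J (length_sub (full_sub M)) by rewrite /J /= map_rcons mem_rcons mem_head.
have [eqJ|/gr_ltP[m [_ nJm /subIJ//]]] := Imax _ cJ.
by rewrite eqJ eqI in Jf.
Qed.

(* Otherwise U would be a direct summand of W: a complement of U.1 in W.1 is a
   submodule concentrated at the sink. *)
Lemma same_top U W : indecomposable_sub U -> indecomposable_sub W ->
  (U.1 <= W.1)%VS -> U.2 = W.2 -> U = W.
Proof.
move=> [subU nzU _] [subW _ indW] s1 e2.
pose B : subspaces M := ((W.1 :\: U.1)%VS, 0%VS).
have subB : submodule B by apply/forallP => i; rewrite limg0 sub0v.
have [||//|/(congr1 fst) /= B0] := indW U B subU subB.
- rewrite /add_sub /= addv0 e2 addvC addv_diff.
  by move/addv_idPl: s1 => ->; case: (W).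
- by rewrite /cap_sub /= capv0 capvC capv_diff.
apply: injective_projections => //; apply: subv_anti; rewrite s1 /=.
by rewrite -diffv_eq0 B0.
Qed.

End Chains.

(** * Invariant subspaces of a nilpotent operator with kernel of dimension at most one *)

Section Uniserial.
Variables (k : fieldType) (V : vectType k) (b : 'End(V)).
Hypothesis kerb : \dim (lker b) <= 1.

(* [iker e] is the kernel of [b ^ e]. *)
Definition iker e : {vspace V} := iter e (fun U => (b @^-1: U)%VS) 0%VS.

Lemma ikerS e : iker e.+1 = (b @^-1: iker e)%VS. Proof. by []. Qed.

Lemma limg_sub_preim U W : (b @: U <= W)%VS = (U <= b @^-1: W)%VS.
Proof.
apply/subvP/subvP => sub v; first by move=> Uv; rewrite -memv_preim sub ?memv_img.
by case/memv_imgP => u Uu ->; rewrite memv_preim sub.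
Qed.

Lemma iker_le e f : e <= f -> (iker e <= iker f)%VS.
Proof.
have step g : (iker g <= iker g.+1)%VS.
  elim: g => [|g IHg]; first by rewrite sub0v.
  rewrite (ikerS g.+1) -limg_sub_preim; apply: subv_trans IHg.
  by rewrite limg_sub_preim.
by move/subnK => <-; elim: (f - e) => // g /subv_trans; apply; apply: step.
Qed.

Lemma dim_capker U : \dim (U :&: lker b) <= 1.
Proof. by apply: leq_trans kerb; rewrite dimvS // capvSr. Qed.

Lemma dim_ikerS e : \dim (iker e.+1) <= (\dim (iker e)).+1.
Proof.
have := limg_ker_dim b (iker e.+1); have := dim_capker (iker e.+1).
have /dimvS : (b @: iker e.+1 <= iker e)%VS by rewrite limg_sub_preim.
by move: (\dim _) (\dim (_ :&: _)) (\dim (b @: _)) => x y z; lia.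
Qed.

Lemma dim_iker_le e : \dim (iker e) <= e.
Proof. by elim: e => [|e IHe]; [rewrite dimv0|apply: leq_trans (dim_ikerS e) _]. Qed.

Variable N : nat.
Hypothesis nilb : iker N = fullv.

(** If b is injective on U then b U = U, and each application of b lowers by one the index of an
    iterated kernel containing U. *)
Lemma capker_neq0 U : (b @: U <= U)%VS -> (U :&: lker b = 0)%VS -> U = 0%VS.
Proof.
move=> bU U0.
have eqU : (b @: U)%VS = U.
  by apply/eqP; rewrite eqEdim bU -(limg_ker_dim b U) U0 dimv0 add0n leqnn.
suff sub e : (U <= iker (N - e))%VS.
  by have := sub N; rewrite subnn subv0 => /eqP.
elim: e => [|e IHe]; first by rewrite subn0 nilb subvf.
have [lt|le] := ltnP e N; last by move: IHe; rewrite (_ : N - e = N - e.+1) //; lia.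
by rewrite -{1}eqU limg_sub_preim -ikerS (_ : (N - e.+1).+1 = N - e) //; lia.
Qed.

(** Hence the invariant subspaces form a single chain. A nonzero invariant U meets the kernel, so b
    U has smaller dimension and induction places it in the preceding iterated kernel. *)
Lemma invariant_iker U : (b @: U <= U)%VS -> U = iker (\dim U).
Proof.
move=> bU; suff sub e : \dim U <= e -> (U <= iker e)%VS.
  by apply/eqP; rewrite eqEdim sub // dim_iker_le.
elim: e U bU => [|e IHe] U bU; first by rewrite leqn0 dimv_eq0 => /eqP->.
move=> leU; rewrite ikerS -limg_sub_preim; have [U0|nzU] := eqVneq U 0%VS.
  by rewrite U0 limg0 sub0v.
apply: IHe; first exact: limgS.
have : \dim (U :&: lker b) != 0.
  by rewrite dimv_eq0; apply: contraNneq nzU => /capker_neq0->.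
by have := limg_ker_dim b U; move: leU; lia.
Qed.

(** If two consecutive iterated kernels coincide, all later ones do too, so growth can stop only at
    the full space. *)
Lemma dim_iker e : e <= \dim {:V} -> \dim (iker e) = e.
Proof.
elim: e => [|e IHe] le_e; first by rewrite dimv0.
apply/eqP; rewrite eqn_leq dim_iker_le ltnNge /=; apply/negP => le.
have eqk : iker e = iker e.+1.
  by apply/eqP; rewrite eqEdim iker_le // IHe // ltnW.
have stat f : iker (f + e) = iker e by elim: f => // f IHf; rewrite addSn ikerS IHf -ikerS.
have := iker_le (leq_addr e N); rewrite nilb stat => /dimvS.
by rewrite (IHe (ltnW le_e)) leqNgt le_e.
Qed.

End Uniserial.

Arguments iker : simpl never.

(** Applied to a decomposition of (W, W), where the identity arrow embeds the second component of
    each summand in the first. *)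
Lemma direct_sum_sub_eq (k : fieldType) (V : vectType k) (A1 A2 B1 B2 : {vspace V}) :
  (A2 <= A1)%VS -> (B2 <= B1)%VS -> (A1 :&: B1 = 0)%VS -> (A2 + B2 = A1 + B1)%VS ->
  A2 = A1 /\ B2 = B1.
Proof.
move=> sA sB cap1 eqs; have dA := dimvS sA; have dB := dimvS sB.
have := dimv_disjoint_sum cap1; have /leqifP := dimv_add_leqif A2 B2.
rewrite -eqs; case: ifP => _ d2 d1; split; apply/eqP; rewrite eqEdim ?sA ?sB /=; lia.
Qed.

Lemma direct_sum_line (k : fieldType) (V : vectType k) (A B : {vspace V}) :
  (A :&: B = 0)%VS -> \dim (A + B) = 1 -> A = 0%VS \/ B = 0%VS.
Proof.
move=> /dimv_disjoint_sum-> d1.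
have [A0|nA0] := eqVneq (\dim A) 0; [left|right]; apply/eqP; rewrite -dimv_eq0.
  by rewrite A0.
by lia.
Qed.

(** * The modules with arrows id, b, c, ..., c *)

Section PairModule.
Variables (k : fieldType) (n : nat) (V : vectType k) (b c : 'End(V)).
Hypothesis n_ge3 : 3 <= n.

Definition pair_module : kronecker_module k n :=
  KroneckerModule (fun i : 'I_n => if val i is 0 then \1%VF
                                   else if val i is 1 then b else c).
Local Notation M := pair_module.
Implicit Types (U X : subspaces M) (s : seq (subspaces M)).

Lemma pair_submoduleP U : reflect
  [/\ (U.2 <= U.1)%VS, (b @: U.2 <= U.1)%VS & (c @: U.2 <= U.1)%VS] (submodule U).
Proof.
apply: (iffP forallP) => [sub|[s0 s1 s2] [[|[|i]] lti]] //=; last by rewrite lim1g.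
have lt0 : 0 < n by lia.
have lt1 : 1 < n by lia.
split; [have := sub (Ordinal lt0)|exact: sub (Ordinal lt1)|exact: sub (Ordinal n_ge3)].
by rewrite /= lim1g.
Qed.

Lemma pair_dim_le U : submodule U -> \dim U.2 <= \dim U.1.
Proof. by case/pair_submoduleP => /dimvS. Qed.

Variable N : nat.
Hypothesis kerb : \dim (lker b) <= 1.
Hypothesis nilb : iker b N = fullv.

(** Both summands have equal components, which are then b-invariant and so comparable. Two
    comparable subspaces with zero intersection cannot both be nonzero. *)
Lemma pair_indecomposable (W : {vspace V}) :
  (b @: W <= W)%VS -> (c @: W <= W)%VS -> W <> 0%VS ->
  indecomposable_sub ((W, W) : subspaces M).
Proof.
move=> bW cW nzW; split; first by apply/pair_submoduleP.
  by case.
move=> A B subA subB /[dup] /(congr1 fst)/= eq1 /(congr1 snd)/= eq2.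
move=> /(congr1 fst)/= cap1.
have [sA bA _] := pair_submoduleP _ subA; have [sB bB _] := pair_submoduleP _ subB.
have [eqA eqB] := direct_sum_sub_eq sA sB cap1 (etrans eq2 (esym eq1)).
rewrite eqA in bA; rewrite eqB in bB.
have iA := invariant_iker kerb nilb bA; have iB := invariant_iker kerb nilb bB.
have [le|/ltnW le] := leqP (\dim A.1) (\dim B.1).
- left; apply: injective_projections; rewrite ?eqA /= -cap1;
  by symmetry; apply/capv_idPl; rewrite iA iB iker_le.
- right; apply: injective_projections; rewrite ?eqB /= -cap1;
  by symmetry; apply/capv_idPr; rewrite iA iB iker_le.
Qed.

(** If the second component grows, then [X'.1] and [X'.2] both have dimension at least e+1, and the
    length bound forces equality. Otherwise [same_top] applies; callers exclude that case by
    comparing lengths. *)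
Lemma pair_chain_step s X X' e : indecomposable_chain s -> X \in s -> X' \in s ->
  \dim X.2 = e -> length_sub X < length_sub X' <= e.*2.+2 ->
  [/\ \dim X'.2 = e.+1, \dim X'.1 = e.+1 & length_sub X' = e.*2.+2] \/ X = X'.
Proof.
move=> ch Xs X's dX /andP[lt le].
have /and3P[s1 s2 neq] := chain_proper ch Xs X's lt.
have [_ ind] := ch; have [subX' _ _] := ind _ X's.
have := pair_dim_le subX'; have [eq2|neq2] := eqVneq X.2 X'.2.
  by right; apply: same_top => //; apply: ind.
have : \dim X.2 < \dim X'.2.
  rewrite ltn_neqAle dimvS // andbT; apply: contraNneq neq2 => eqd.
  by rewrite eqEdim s2 eqd leqnn.
by left; move: le; rewrite /length_sub; split; lia.
Qed.

(** The lengths 1, 2, 4, ..., 2e force the second dimension up by exactly one at each even length.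
    The [maxn] covers e = 0, where the term is simple of length 1. *)
Lemma pair_chain_stem s e : indecomposable_chain s ->
  (forall l, (l == 1) || ~~ odd l && (0 < l <= e.*2) ->
     l \in map (@length_sub k n M) s) ->
  exists2 X : subspaces M, X \in s & \dim X.2 = e /\ length_sub X = maxn 1 e.*2.
Proof.
move=> ch; elim: e => [|e IHe] stem.
  have /mapP[X Xs lX] : 1 \in map (@length_sub k n M) s by apply: stem.
  exists X => //; split; last by rewrite -lX.
  have [_ ind] := ch; have [/pair_dim_le leX _ _] := ind X Xs.
  by move: lX; rewrite /length_sub; move: leX; lia.
have [l lS|X Xs [dX lX]] := IHe; first by apply: stem; lia.
have /mapP[X' X's lX'] : e.*2.+2 \in map (@length_sub k n M) s.
  by apply: stem; rewrite /= odd_double; lia.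
have bnd : length_sub X < length_sub X' <= e.*2.+2 by rewrite lX -lX'; lia.
have [[d2 d1 _]|eqX] := pair_chain_step ch Xs X's dX bnd.
  by exists X' => //; split=> //; rewrite -lX'; lia.
by move: bnd; rewrite eqX ltnn.
Qed.

Variable d : nat.
Hypotheses (d_gt0 : 0 < d) (dV : d < \dim {:V}).
Hypothesis cinv : forall e, e <= d -> (c @: iker b e <= iker b e)%VS.
Hypothesis cninv : ~~ (c @: iker b d.+1 <= iker b d.+1)%VS.

(* The set {1, 2, 4, 6, ..., 2d}. *)
Definition stem l := (l == 1) || ~~ odd l && (0 < l <= d.*2).

Lemma iker_indecomposable e : 0 < e <= d ->
  indecomposable_sub ((iker b e, iker b e) : subspaces M).
Proof.
move=> /andP[e_gt0 le_ed]; apply: pair_indecomposable.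
- by rewrite limg_sub_preim -ikerS iker_le.
- exact: cinv.
- by move/(congr1 (@dimv _ _)); rewrite (dim_iker kerb nilb) ?dimv0; lia.
Qed.

Definition stem_chain : seq (subspaces M) :=
  (iker b 1, 0%VS) :: [seq (iker b e, iker b e) | e <- iota 1 d].

(** This makes the stem a lower bound for mu(M). The first term of the chain is simple at the sink,
    the others have dimension vectors (e, e). *)
Lemma stem_chain_lengths : chain_lengths M [set l | stem l].
Proof.
have diker e : e <= d -> \dim (iker b e) = e.
  by move=> le; rewrite (dim_iker kerb nilb) //; lia.
exists stem_chain; last first.
  apply/seteqP; split=> l /=; rewrite -map_comp.
    move=> st; rewrite inE; apply/orP; have [->|neq1] := eqVneq l 1.
      by left; rewrite /length_sub /= diker ?dimv0.
    right; apply/mapP; exists l./2; first by rewrite mem_iota; move: st; rewrite /stem; lia.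
    by rewrite /length_sub /= diker; move: st; rewrite /stem; lia.
  rewrite inE => /orP[/eqP->|/mapP[e]].
    by rewrite /length_sub /= diker ?dimv0.
  rewrite mem_iota => le ->; rewrite /length_sub /= diker ?addnn /stem ?odd_double; lia.
split.
  rewrite /stem_chain (sorted_pairwise (@proper_sub_trans _ _ _)) /= all_map.
  apply/andP; split.
    apply/allP => e; rewrite mem_iota => le /=.
    rewrite /Defs.proper_sub /= iker_le ?sub0v; last by lia.
    apply/eqP => /(congr1 snd) /= /(congr1 (@dimv _ _)).
    by rewrite dimv0 diker; lia.
  rewrite pairwise_map.
  apply: (sub_in_pairwise (P := [pred e | e <= d]) (r := ltn)); first last.
  - by rewrite -(sorted_pairwise ltn_trans) iota_ltn_sorted.
  - by apply/allP => e; rewrite mem_iota inE; lia.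
  move=> e f; rewrite !inE => led lfd ltef.
  have sef : (iker b e <= iker b f)%VS by apply/iker_le/ltnW.
  apply/and3P; split=> //; apply/eqP => /(congr1 snd) /= /(congr1 (@dimv _ _)).
  by rewrite !diker // => eqef; move: ltef; rewrite eqef /= ltnn.
move=> U; rewrite inE => /orP[/eqP->|/mapP[e]]; last first.
  by rewrite mem_iota => le ->; apply: iker_indecomposable; lia.
have d1 : \dim (iker b 1) = 1 by apply: diker.
split.
- by apply/pair_submoduleP; rewrite /= !limg0 !sub0v.
- by move/(congr1 fst)/(congr1 (@dimv _ _)); rewrite /= d1 dimv0.
move=> A B _ _ /[dup] /(congr1 fst)/= eq1 /(congr1 snd)/= eq2 /(congr1 fst)/= cap1.
have A2 : A.2 = 0%VS by apply/eqP; rewrite -subv0 -eq2 addvSl.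
have B2 : B.2 = 0%VS by apply/eqP; rewrite -subv0 -eq2 addvSr.
rewrite -eq1 in d1; have [A1|B1] := direct_sum_line cap1 d1.
  by left; apply: injective_projections.
by right; apply: injective_projections.
Qed.

(* At the first disagreement a submodule of length 2d+2 with both dimensions equal
   to d+1 would appear, making [ker b^(d+1)] invariant under [c]. *)
Lemma pair_mu_stem I : is_mu M I -> forall l, l <= d.*2.+2 -> (I l <-> stem l).
Proof.
move=> [cI Imax] l le_l.
(* Either [I] is the stem, or it is larger and [m] is the first difference, in [I] but not in the
   stem. *)
have [<-//|/gr_ltP[m [agree nstem Im]]] := Imax _ stem_chain_lengths.
have [ltm|lem] := ltnP l m; first by have := agree l ltm => /= <-.
have /andP[m_gt0 _] := chain_lengths_bound cI Im.
have {}nstem : ~~ stem m by apply/negP.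
have [s ch eqI] := cI; have [_ ind] := ch.
(* With this [e], the numbers 1, 2, 4, ..., 2e all lie below [m], and [m] is at most 2e+2, as
   [pair_chain_step] requires. *)
pose e := (m.-1)./2.
have m_cases : (0 < e <= d /\ m = e.*2.+1) \/ e = d /\ m = d.*2.+2.
  by move: nstem; rewrite /stem /e; lia.
clearbody e; have [|X Xs [dX lX]] := pair_chain_stem (e := e) ch.
  move=> j js; have : stem j by move: js; rewrite /stem; lia.
  have /agree : j < m by move: js; lia.
  by move=> [+ _] stj => /(_ stj); rewrite eqI.
move: Im; rewrite eqI => /mapP[X' X's lX'].
have bnd : length_sub X < length_sub X' <= e.*2.+2 by rewrite lX -lX'; lia.
have [[d2 d1 l2]|eqX] := pair_chain_step ch Xs X's dX bnd; last first.
  by move: bnd; rewrite eqX ltnn.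
(* [X'] has even length 2e+2 = m, which excludes the odd values of [m] and leaves m = 2d+2. *)
have eqed : e = d by lia.
have [/pair_submoduleP[s0 s1 s2] _ _] := ind _ X's.
have eqX : X'.1 = X'.2 by apply/esym/eqP; rewrite eqEdim s0 d1 d2 leqnn.
rewrite eqX in s1 s2; have iX := invariant_iker kerb nilb s1.
by case/negP: cninv; rewrite -eqed -d2 -iX.
Qed.

End PairModule.

(** * A Jordan block and a matrix unit *)

Section JordanPair.
Variables (k : fieldType) (N : nat).
Local Notation V := 'rV[k]_N.
Local Open Scope ring_scope.

(** Extension by zero beyond N lets the shift formula [coef_jordan] hold for every index. *)
Definition coef (x : V) (j : nat) : k := if insub j is Some i then x 0 i else 0.

Lemma coef_ord x (i : 'I_N) : coef x i = x 0 i.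
Proof. by rewrite /coef valK. Qed.

Lemma coef_ge x j : (N <= j)%N -> coef x j = 0.
Proof. by move=> le; rewrite /coef insubN // -leqNgt. Qed.

Lemma coefP x : x = 0 <-> forall j, coef x j = 0.
Proof.
split=> [-> j|x0]; first by rewrite /coef; case: insub => // i; rewrite mxE.
by apply/rowP => i; rewrite -coef_ord x0 mxE.
Qed.

Definition jordan : 'End(V) :=
  linfun (mulmxr (\matrix_(i < N, j < N) ((i == j.+1 :> nat)%:R : k))).

Lemma coef_jordan x j : coef (jordan x) j = coef x j.+1.
Proof.
have [ltj|lej] := ltnP j N; last by rewrite !coef_ge // ltnW.
rewrite (coef_ord _ (Ordinal ltj)) lfunE /= mxE.
have [ltj1|lej1] := ltnP j.+1 N; last first.
  rewrite coef_ge // big1 // => i _; rewrite mxE /=.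
  by rewrite ltn_eqF ?mulr0 // (leq_trans (ltn_ord i)).
rewrite (coef_ord _ (Ordinal ltj1)) (bigD1 (Ordinal ltj1)) //= mxE eqxx mulr1.
rewrite big1 ?addr0 // => i neq; rewrite mxE /=.
by have -> : (i == j.+1 :> nat) = false by [apply/negbTE]; rewrite mulr0.
Qed.

(** The iterated kernels are the spans of initial segments of the standard basis, since the Jordan
    block shifts coordinates down by one. *)
Lemma mem_iker_jordan e x :
  x \in iker jordan e <-> forall j, (e <= j)%N -> coef x j = 0.
Proof.
elim: e x => [|e IHe] x.
  rewrite memv0; split=> [/eqP/coefP x0 j _|x0]; first exact: x0.
  by apply/eqP/coefP => j; apply: x0.
rewrite ikerS -memv_preim IHe; split=> x0 j lej.
  by case: j lej => // j lej; rewrite -coef_jordan x0.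
by rewrite coef_jordan x0.
Qed.

Lemma iker_jordan_full : iker jordan N = fullv.
Proof.
by apply/vspaceP => x; rewrite memvf; apply/mem_iker_jordan => j /coef_ge->.
Qed.

Lemma dim_ker_jordan : (0 < N)%N -> (\dim (lker jordan) <= 1)%N.
Proof.
move=> N_gt0; pose e0 : V := delta_mx 0 (Ordinal N_gt0).
apply: leq_trans (_ : \dim <[e0]> <= 1)%N; last by rewrite dim_vline leq_b1.
apply/dimvS/subvP => x; rewrite memv_ker => /eqP /coefP x0.
apply/vlineP; exists (coef x 0); apply/rowP => i; rewrite !mxE -coef_ord eqxx /=.
case: i => [[|i] lti] /=; rewrite -?coef_jordan ?x0 ?mulr0 //.
by rewrite mulr1.
Qed.

Variable d : nat.
Hypothesis dN : (d.+1 < N)%N.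

(** Counting basis vectors from 0, this sends the d-th to the next one and kills the others. It thus
    vanishes on the iterated kernels up to index d and leads out of the one of index d+1. *)
Definition jump : 'End(V) :=
  linfun (mulmxr (delta_mx (Ordinal (ltnW dN)) (Ordinal dN))).

Lemma jumpE x : jump x = coef x d *: delta_mx 0 (Ordinal dN).
Proof.
rewrite lfunE /=; apply/rowP => j; rewrite !mxE (bigD1 (Ordinal (ltnW dN))) //=.
rewrite big1 ?addr0 => [|i neq]; first by rewrite mxE eqxx -coef_ord.
by rewrite mxE (negbTE neq) mulr0.
Qed.

Lemma jump_iker e : (e <= d)%N -> (jump @: iker jordan e <= iker jordan e)%VS.
Proof.
move=> led; apply/subvP => _ /memv_imgP[x /mem_iker_jordan x0 ->].
by rewrite jumpE x0 // scale0r mem0v.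
Qed.

Lemma jump_not_iker : ~~ (jump @: iker jordan d.+1 <= iker jordan d.+1)%VS.
Proof.
apply/negP => /subvP sub; pose x : V := delta_mx 0 (Ordinal (ltnW dN)).
have xd : coef x d = 1 by rewrite (coef_ord _ (Ordinal (ltnW dN))) mxE !eqxx.
have xW : x \in iker jordan d.+1.
  apply/mem_iker_jordan => j ltdj; have [ltj|/coef_ge//] := ltnP j N.
  by rewrite (coef_ord _ (Ordinal ltj)) mxE /= -val_eqE /= gtn_eqF.
have /mem_iker_jordan/(_ d.+1 (leqnn _)) := sub _ (memv_img _ xW).
rewrite jumpE xd scale1r (coef_ord _ (Ordinal dN)) mxE !eqxx => /eqP.
by rewrite oner_eq0.
Qed.

End JordanPair.

(** * Infinite, pairwise separated families of measures *)

Definition stem_cone d : set (set nat) :=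
  [set I | forall l, l <= d.*2.+2 -> (I l <-> stem d l)].

(** The last two clauses make 2N the largest element of [I], so different N give different
    measures. *)
Lemma gr_measure_in_stem_cone (k : fieldType) n d N :
  3 <= n -> 0 < d -> d.+1 < N ->
  exists I, [/\ gr_measure k n I, stem_cone d I, I N.*2 & forall l, I l -> l <= N.*2].
Proof.
move=> n_ge3 d_gt0 dN; pose M := pair_module n (jordan k N) (jump k dN).
have dimV : \dim {:'rV[k]_N} = N by rewrite dimvf /dim /= mul1n.
have lenM : length_sub (full_sub M) = N.*2 by rewrite /length_sub /= !dimvf /dim /= mul1n addnn.
have kerb := dim_ker_jordan k (ltn_trans (ltn0Sn d) dN); have nilb := iker_jordan_full k N.
have indM : indecomposable M.
  apply: (pair_indecomposable n_ge3 kerb nilb); rewrite ?subvf //.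
  by move=> /(congr1 (@dimv _ _)); rewrite dimV dimv0; lia.
have [I muI] := mu_exists M; exists I; split.
- by exists M.
- apply: (pair_mu_stem n_ge3 kerb nilb d_gt0 _ _ _ muI).
  + by rewrite dimV ltnW.
  + by move=> e; apply: jump_iker.
  + exact: jump_not_iker.
- by rewrite -lenM; apply: mu_length.
- by move=> l Il; rewrite -lenM; have [cI _] := muI; case/andP: (chain_lengths_bound cI Il).
Qed.

Lemma infinite_stem_cone (k : fieldType) n d : 3 <= n -> 0 < d ->
  infinite_set [set I | gr_measure k n I /\ stem_cone d I].
Proof.
move=> n_ge3 d_gt0.
(* N = d+2+t runs through all values with d+1 < N. *)
have ex t : exists I, [/\ gr_measure k n I, stem_cone d I, I (d.+2 + t).*2 &
    forall l, I l -> l <= (d.+2 + t).*2].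
  by apply: gr_measure_in_stem_cone => //; lia.
have [f fP] := choice ex.
apply: (@infinite_set_injection _ _ f) => [s t eqf|t]; last by case: (fP t).
have [_ _ fs les] := fP s; have [_ _ ft ler] := fP t.
rewrite eqf in fs les; have := les _ ft; have := ler _ fs; lia.
Qed.

(** The first difference is at 2d+2, which the cone condition excludes from [I] and puts into
    [J]. *)
Lemma stem_cone_lt d I J : stem_cone d I -> stem_cone d.+1 J -> gr_lt I J.
Proof.
move=> CI CJ; apply/gr_ltP; exists d.*2.+2; split=> [i lti||].
- by rewrite CI ?CJ 1?/stem; lia.
- by rewrite CI // /stem; lia.
- by rewrite CJ /stem; lia.
Qed.

Theorem theorem4p8 (k : closedFieldType) (n : nat) (hn : (3 <= n)%N) :
  infinite_set [set S : set (set nat) | gr_segment k n S]%classic.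
Proof.
(* The shift by one supplies the positivity required by [infinite_stem_cone]. *)
apply: (infinitely_many_segments (C := fun d => stem_cone d.+1)).
  by move=> d; apply: infinite_stem_cone.
by move=> d I J; apply: stem_cone_lt.
Qed.
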